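(* Let $H$ be an algebraic group that is a semidirect product of the one-dimensional torus $\Bbbk^*$ and the additive group $\Bbbk$, with $\Bbbk$ as the normal factor (the action of $\Bbbk^*$ on $\Bbbk$ being algebraic). Then $H$ has a finite extension with a periodic component if and only if $H$ is isomorphic to the direct product $\Bbbk^*\times\Bbbk$.
   Context: $\Bbbk$ is an algebraically closed field of characteristic zero; $\Bbbk^*$ denotes its multiplicative group and $\Bbbk$ its additive group, as algebraic groups. A connected component of an affine algebraic group is called periodic if all its elements have finite order. A finite extension of a connected affine algebraic group $H$ is an affine algebraic group $G$ with identity component $G^0= H$; it ''has a periodic component'' if some connected component of $G$ is periodic. *)

(* Defs.v *)
From HB Require Import structures.
From mathcomp Require Import all_boot all_order all_algebra.
From mathcomp Require Import boolp classical_sets topology.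
From mathcomp Require Import mpoly.

Set Implicit Arguments.
Unset Strict Implicit.
Unset Printing Implicit Defensive.

Import GRing.Theory.
Local Open Scope classical_set_scope.
Local Open Scope ring_scope.

Section AffineSpace.
Variable k : closedFieldType.

Definition zero_locus n (S : set {mpoly k[n]}) : set 'rV[k]_n :=
  [set x | forall p, S p -> p.@[x 0] = 0].

Definition poly_map n m (P : m.-tuple {mpoly k[n]}) (x : 'rV[k]_n) : 'rV[k]_m :=
  \row_i (tnth P i).@[x 0].

(* An alias of 'rV[k]_n, so that the Zariski topology declared on it cannot be
   confused with the product topology that the library puts on matrices.     *)
Definition affine_space n : Type := 'rV[k]_n.
HB.instance Definition _ n := Choice.on (affine_space n).

Definition zariski_open n : set_system (affine_space n) :=
  [set U | exists S, U = ~` zero_locus S].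

Lemma zariski_openT n : zariski_open [set: affine_space n].
Proof.
exists [set 1]; rewrite -[LHS]setC0; congr (~` _).
apply/seteqP; split=> // x /(_ 1 erefl) /eqP.
by rewrite meval1 oner_eq0.
Qed.

Lemma zariski_openI n : setI_closed (@zariski_open n).
Proof.
move=> _ _ [S ->] [T ->].
exists [set r | exists p q, [/\ S p, T q & r = p * q]].
rewrite -setCU; congr (~` _); apply/seteqP; split=> x.
  by case=> H _ [p [q [Sp Tq ->]]]; rewrite mevalM;
    [rewrite (H p Sp) mul0r | rewrite (H q Tq) mulr0].
move=> H; apply: contrapT => /not_orP [].
move=> /existsNP [p /not_implyP [Sp /eqP px]].
move=> /existsNP [q /not_implyP [Tq /eqP qx]].
have := H (p * q) (ex_intro _ p (ex_intro _ q (And3 Sp Tq erefl))).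
by rewrite mevalM => /eqP; rewrite mulf_eq0 (negPf px) (negPf qx).
Qed.

Lemma zariski_open_bigcup n (I : Type) (f : I -> set (affine_space n)) :
  (forall i, zariski_open (f i)) -> zariski_open (\bigcup_i f i).
Proof.
move=> /choice [S fS]; exists [set p | exists i, S i p].
rewrite -[LHS]setCK setC_bigcup; congr (~` _); apply/seteqP; split=> x.
  by move=> H p [i Sip]; have := H i Logic.I; rewrite fS setCK => /(_ p Sip).
by move=> H i _; rewrite fS setCK => p Sip; apply: H; exists i.
Qed.

HB.instance Definition _ n := isOpenTopological.Build (affine_space n)
  (@zariski_openT n) (@zariski_openI n) (@zariski_open_bigcup n).

End AffineSpace.

(* An affine variety is a type of points with a bijection onto a closed
   algebraic subset of some affine space; it may be reducible.               *)
HB.mixin Record isAffineVariety (k : closedFieldType) (X : Type) := {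
  adim : nat;
  coord : X -> 'rV[k]_adim;
  coord_inj : injective coord;
  coord_closed : exists S, range coord = zero_locus S
}.

#[short(type="affineVarietyType")]
HB.structure Definition AffineVariety (k : closedFieldType) :=
  {X of Choice X & isAffineVariety k X}.

Arguments adim {k} X : rename.
Arguments coord_closed {k} X : rename.

Definition is_morphism (k : closedFieldType) (X Y : affineVarietyType k)
    (f : X -> Y) : Prop :=
  exists P, forall x, coord (f x) = poly_map P (coord x).

Definition zariski (k : closedFieldType) (X : affineVarietyType k) :=
  initial_topology (coord : X -> affine_space k (adim X)).

Section ProductVariety.
Variables (k : closedFieldType) (X Y : affineVarietyType k).

Definition prod_coord (z : X * Y) : 'rV[k]_(adim X + adim Y) :=
  row_mx (coord z.1) (coord z.2).

Lemma prod_coord_inj : injective prod_coord.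
Proof. by case=> [x y] [x' y'] /eq_row_mx [/= /coord_inj -> /coord_inj ->]. Qed.

Lemma prod_coord_closed : exists S, range prod_coord = zero_locus S.
Proof.
have [S XS] := coord_closed X; have [T YT] := coord_closed Y.
pose l : (adim X).-tuple {mpoly k[adim X + adim Y]} :=
  [tuple 'X_(lshift _ i) | i < adim X].
pose r : (adim Y).-tuple {mpoly k[adim X + adim Y]} :=
  [tuple 'X_(rshift _ i) | i < adim Y].
have lE p (v : 'rV[k]_(adim X + adim Y)) :
    (p \mPo l).@[v 0] = p.@[(lsubmx v : 'rV[k]_(adim X)) 0].
  by rewrite comp_mpoly_meval; apply: meval_eq => i; rewrite tnth_mktuple mevalXU mxE.
have rE p (v : 'rV[k]_(adim X + adim Y)) :
    (p \mPo r).@[v 0] = p.@[(rsubmx v : 'rV[k]_(adim Y)) 0].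
  by rewrite comp_mpoly_meval; apply: meval_eq => i; rewrite tnth_mktuple mevalXU mxE.
exists [set q | (exists2 p, S p & q = p \mPo l) \/ (exists2 p, T p & q = p \mPo r)].
apply/seteqP; split=> [_ [[x y] _ <-] q|v Hv].
  have Sx : zero_locus S (coord x) by rewrite -XS; exists x.
  have Ty : zero_locus T (coord y) by rewrite -YT; exists y.
  by case=> [[p Sp ->]|[p Tp ->]]; rewrite ?lE ?rE ?row_mxKl ?row_mxKr;
     [exact: Sx | exact: Ty].
have [x _ xE] : range (coord (s := X)) (lsubmx v).
  by rewrite XS => p Sp; rewrite -lE; apply: Hv; left; exists p.
have [y _ yE] : range (coord (s := Y)) (rsubmx v).
  by rewrite YT => p Tp; rewrite -rE; apply: Hv; right; exists p.
by exists (x, y) => //; rewrite /prod_coord /= xE yE hsubmxK.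
Qed.

HB.instance Definition _ := isAffineVariety.Build k (X * Y)%type
  prod_coord_inj prod_coord_closed.

Lemma fst_morphism : is_morphism (fst : X * Y -> X).
Proof.
exists [tuple 'X_(lshift _ i) | i < adim X] => -[x y]; apply/rowP => i.
by rewrite mxE tnth_mktuple mevalXU row_mxEl.
Qed.

Lemma snd_morphism : is_morphism (snd : X * Y -> Y).
Proof.
exists [tuple 'X_(rshift _ i) | i < adim Y] => -[x y]; apply/rowP => i.
by rewrite mxE tnth_mktuple mevalXU row_mxEr.
Qed.

End ProductVariety.

Section Morphisms.
Variables (k : closedFieldType) (X Y Z : affineVarietyType k).

Lemma comp_morphism (g : Y -> Z) (f : X -> Y) :
  is_morphism g -> is_morphism f -> is_morphism (fun x => g (f x)).
Proof.
move=> [Q gQ] [P fP]; exists [tuple tnth Q i \mPo P | i < adim Z] => x.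
apply/rowP => i; rewrite gQ !mxE tnth_mktuple comp_mpoly_meval.
by apply: meval_eq => j; rewrite fP mxE.
Qed.

Lemma pair_morphism (f : X -> Y) (g : X -> Z) :
  is_morphism f -> is_morphism g -> is_morphism (fun x => (f x, g x)).
Proof.
move=> [P fP] [Q gQ]; exists (cat_tuple P Q) => x; apply/rowP => i.
rewrite [LHS]mxE [RHS]mxE; case: (splitP i) => j ij.
  rewrite fP mxE; congr (_.@[_]); rewrite !(tnth_nth 0) /= ij.
  by rewrite nth_cat size_tuple ltn_ord.
rewrite gQ mxE; congr (_.@[_]); rewrite !(tnth_nth 0) /= ij.
by rewrite nth_cat size_tuple ltnNge leq_addr /= addKn.
Qed.

End Morphisms.

HB.mixin Record isAlgGroup (k : closedFieldType) G
    of Group G & AffineVariety k G := {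
  mulg_morphism : is_morphism (fun z : G * G => (z.1 * z.2)%g);
  invg_morphism : is_morphism (fun x : G => (x^-1)%g)
}.

#[short(type="algGroupType")]
HB.structure Definition AlgGroup (k : closedFieldType) :=
  {G of Group G & AffineVariety k G & isAlgGroup k G}.

Section AlgGroups.
Variable k : closedFieldType.

Definition isomorphic (G H : algGroupType k) : Prop :=
  exists (f : G -> H) (g : H -> G),
    [/\ cancel f g, cancel g f, {morph f : x y / (x * y)%g},
        is_morphism f & is_morphism g].

Definition component (G : algGroupType k) (g : G) : set G :=
  connected_component [set: zariski G] g.

Definition identity_component (G : algGroupType k) : set G := component 1%g.
Arguments identity_component : clear implicits.

Definition periodic (G : algGroupType k) (C : set G) : Prop :=
  forall x, C x -> exists2 n, (0 < n)%N & (x ^+ n)%g = 1%g.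

(* i identifies H, as an algebraic group, with the identity component of G:
   the polynomial map Q induces the inverse of i on its image.               *)
Definition is_finite_extension (H G : algGroupType k) (i : H -> G) : Prop :=
  [/\ {morph i : x y / (x * y)%g}, is_morphism i,
      exists Q, forall h, coord h = poly_map Q (coord (i h))
    & range i = identity_component G].

Definition has_finite_extension_with_periodic_component
    (H : algGroupType k) : Prop :=
  exists (G : algGroupType k) (i : H -> G),
    is_finite_extension i /\ exists g : G, periodic (component g).

End AlgGroups.

Section MultiplicativeGroup.
Variable k : closedFieldType.

Definition Gm : Type := {x : k | x != 0}.
HB.instance Definition _ := Choice.on Gm.

Let Gm_one : Gm := exist _ 1 (oner_neq0 k).
Let Gm_mul (x y : Gm) : Gm := exist _ (val x * val y) (mulf_neq0 (valP x) (valP y)).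
Let Gm_inv (x : Gm) : Gm := exist _ (val x)^-1 (invr_neq0 (valP x)).

Let Gm_mulA : associative Gm_mul.
Proof. by move=> x y z; apply/val_inj; rewrite /= mulrA. Qed.
Let Gm_mul1 : left_id Gm_one Gm_mul.
Proof. by move=> x; apply/val_inj; rewrite /= mul1r. Qed.
Let Gm_mulr1 : right_id Gm_one Gm_mul.
Proof. by move=> x; apply/val_inj; rewrite /= mulr1. Qed.
Let Gm_mulV : left_inverse Gm_one Gm_inv Gm_mul.
Proof. by move=> x; apply/val_inj; rewrite /= mulVf ?(valP x). Qed.
Let Gm_mulrV : right_inverse Gm_one Gm_inv Gm_mul.
Proof. by move=> x; apply/val_inj; rewrite /= divff ?(valP x). Qed.

HB.instance Definition _ :=
  isGroup.Build Gm Gm_mulA Gm_mul1 Gm_mulr1 Gm_mulV Gm_mulrV.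

(* The hyperbola model {(a, b) | a b = 1}. *)
Definition Gm_coord (x : Gm) : 'rV[k]_2 :=
  \row_(i < 2) (if i == 0 then val x else (val x)^-1).

Lemma Gm_coord_inj : injective Gm_coord.
Proof. by move=> x y /rowP /(_ 0); rewrite !mxE => /val_inj. Qed.

Lemma Gm_coord_closed : exists S, range Gm_coord = zero_locus S.
Proof.
exists [set 'X_0 * 'X_1 - 1]; apply/seteqP; split=> [_ [x _ <-] _ ->|v].
  by rewrite mevalB mevalM !mevalXU meval1 !mxE /= divff ?subrr ?(valP x).
move=> /(_ _ erefl); rewrite mevalB mevalM !mevalXU meval1 => /subr0_eq v1.
have v0 : v 0 0 != 0 by apply: contra_eq_neq v1 => ->; rewrite mul0r eq_sym oner_eq0.
exists (exist _ (v 0 0) v0) => //; apply/rowP => i; rewrite mxE /=.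
case: ifP => [/eqP -> //|i0]; have -> : i = 1 by case: i i0 => -[|[]] // *; apply: val_inj.
by rewrite -[LHS]mulr1 -v1 mulKf.
Qed.

HB.instance Definition _ := isAffineVariety.Build k Gm
  Gm_coord_inj Gm_coord_closed.

Lemma Gm_mul_morphism : is_morphism (fun z : Gm * Gm => (z.1 * z.2)%g).
Proof.
exists [tuple 'X_(lshift 2 i) * 'X_(rshift 2 i) | i < 2] => -[x y].
apply/rowP => i; rewrite [RHS]mxE tnth_mktuple mevalM !mevalXU.
rewrite row_mxEl row_mxEr !mxE /=.
by case: ifP => //; rewrite invfM.
Qed.

Lemma Gm_inv_morphism : is_morphism (fun x : Gm => (x^-1)%g).
Proof.
exists [tuple 'X_(rev_ord i) | i < 2] => x.
apply/rowP => -[[|[|//]] Hi]; rewrite [RHS]mxE tnth_mktuple mevalXU !mxE //=.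
by rewrite invrK.
Qed.

HB.instance Definition _ :=
  isAlgGroup.Build k Gm Gm_mul_morphism Gm_inv_morphism.

End MultiplicativeGroup.

Section AdditiveGroup.
Variable k : closedFieldType.

(* The additive group of k, with its law written multiplicatively. *)
Definition Ga : Type := k.
HB.instance Definition _ := Choice.on Ga.
HB.instance Definition _ := isGroup.Build Ga
  (@addrA k) (@add0r k) (@addr0 k) (@addNr k) (@addrN k).

Definition Ga_coord (x : Ga) : 'rV[k]_1 := const_mx x.

Lemma Ga_coord_inj : injective Ga_coord.
Proof. by move=> x y /rowP /(_ 0); rewrite !mxE. Qed.

Lemma Ga_coord_closed : exists S, range Ga_coord = zero_locus S.
Proof.
exists set0; apply/seteqP; split=> [_ _ p []|v _].
by exists (v 0 0) => //; apply/rowP => i; rewrite mxE ord1.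
Qed.

HB.instance Definition _ := isAffineVariety.Build k Ga
  Ga_coord_inj Ga_coord_closed.

Lemma Ga_mul_morphism : is_morphism (fun z : Ga * Ga => (z.1 * z.2)%g).
Proof.
exists [tuple 'X_(lshift 1 i) + 'X_(rshift 1 i) | i < 1] => -[x y].
apply/rowP => i; rewrite [RHS]mxE tnth_mktuple mevalD !mevalXU.
by rewrite row_mxEl row_mxEr !mxE.
Qed.

Lemma Ga_inv_morphism : is_morphism (fun x : Ga => (x^-1)%g).
Proof.
exists [tuple - 'X_i | i < 1] => x.
by apply/rowP => i; rewrite [RHS]mxE tnth_mktuple mevalN mevalXU !mxE.
Qed.

HB.instance Definition _ :=
  isAlgGroup.Build k Ga Ga_mul_morphism Ga_inv_morphism.

End AdditiveGroup.

Section DirectProduct.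
Variables (k : closedFieldType) (G H : algGroupType k).
Local Open Scope group_scope.

Let mul (x y : G * H) : G * H := (x.1 * y.1, x.2 * y.2).
Let inv (x : G * H) : G * H := (x.1^-1, x.2^-1).

Let mulA : associative mul.
Proof. by move=> x y z; rewrite /mul /= !mulgA. Qed.
Let mul1 : left_id (1, 1) mul.
Proof. by move=> [x y]; rewrite /mul /= !mul1g. Qed.
Let mulr1 : right_id (1, 1) mul.
Proof. by move=> [x y]; rewrite /mul /= !mulg1. Qed.
Let mulV : left_inverse (1, 1) inv mul.
Proof. by move=> x; rewrite /mul /= !mulVg. Qed.
Let mulrV : right_inverse (1, 1) inv mul.
Proof. by move=> x; rewrite /mul /= !mulgV. Qed.

HB.instance Definition _ :=
  isGroup.Build (G * H)%type mulA mul1 mulr1 mulV mulrV.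

Lemma prod_mul_morphism :
  is_morphism (fun z : (G * H) * (G * H) => z.1 * z.2).
Proof.
have p1 := @fst_morphism k (G * H)%type (G * H)%type.
have p2 := @snd_morphism k (G * H)%type (G * H)%type.
have q1 := @fst_morphism k G H; have q2 := @snd_morphism k G H.
apply: pair_morphism.
  apply: (comp_morphism (g := fun z : G * G => z.1 * z.2)
    (f := fun z : (G * H) * (G * H) => (z.1.1, z.2.1))).
    exact: mulg_morphism.
  by apply: pair_morphism; apply: (comp_morphism q1).
apply: (comp_morphism (g := fun z : H * H => z.1 * z.2)
  (f := fun z : (G * H) * (G * H) => (z.1.2, z.2.2))).
  exact: mulg_morphism.
by apply: pair_morphism; apply: (comp_morphism q2).
Qed.

Lemma prod_inv_morphism : is_morphism (fun x : G * H => x^-1).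
Proof.
apply: pair_morphism.
  by apply: (comp_morphism (@invg_morphism k G)); apply: fst_morphism.
by apply: (comp_morphism (@invg_morphism k H)); apply: snd_morphism.
Qed.

HB.instance Definition _ :=
  isAlgGroup.Build k (G * H)%type prod_mul_morphism prod_inv_morphism.

End DirectProduct.

Record alg_action (k : closedFieldType) (Q N : algGroupType k) := AlgAction {
  act :> Q -> N -> N;
  act1 : forall x, act 1%g x = x;
  actM : forall q r x, act (q * r)%g x = act q (act r x);
  act_mulg : forall q, {morph act q : x y / (x * y)%g};
  act_morphism : is_morphism (fun z : Q * N => act z.1 z.2)
}.

(* N is the normal factor. The type ignores a, but serves as a key for the
   group structure twisted by a that is declared below.                     *)
Definition semidirect (k : closedFieldType) (Q N : algGroupType k)
  (a : alg_action Q N) : Type := (N * Q)%type.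

Section SemidirectProduct.
Variables (k : closedFieldType) (Q N : algGroupType k) (a : alg_action Q N).
Local Open Scope group_scope.

Local Notation semidirect := (semidirect a).

HB.instance Definition _ := AffineVariety.copy semidirect (N * Q)%type.

Let mul (x y : semidirect) : semidirect := (x.1 * a x.2 y.1, x.2 * y.2).
Let one : semidirect := (1, 1).
Let inv (x : semidirect) : semidirect := (a x.2^-1 x.1^-1, x.2^-1).

Let act_one q : a q 1 = 1.
Proof. by apply: (mulgI (a q 1)); rewrite -act_mulg !mulg1. Qed.
Let mulA : associative mul.
Proof. by move=> x y z; rewrite /mul /= act_mulg actM !mulgA. Qed.
Let mul1 : left_id one mul.
Proof. by move=> [x q]; rewrite /mul /= act1 !mul1g. Qed.
Let mulr1 : right_id one mul.
Proof. by move=> [x q]; rewrite /mul /= act_one !mulg1. Qed.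
Let mulV : left_inverse one inv mul.
Proof. by move=> x; rewrite /mul /= -act_mulg !mulVg act_one. Qed.
Let mulrV : right_inverse one inv mul.
Proof. by move=> x; rewrite /mul /= -actM !mulgV act1 mulgV. Qed.

HB.instance Definition _ :=
  isGroup.Build semidirect mulA mul1 mulr1 mulV mulrV.

Lemma semidirect_mul_morphism :
  is_morphism (fun z : semidirect * semidirect => z.1 * z.2).
Proof.
have p1 := @fst_morphism k (N * Q)%type (N * Q)%type.
have p2 := @snd_morphism k (N * Q)%type (N * Q)%type.
have q1 := @fst_morphism k N Q; have q2 := @snd_morphism k N Q.
apply: (@pair_morphism k ((N * Q) * (N * Q))%type N Q).
  apply: (comp_morphism (g := fun z : N * N => z.1 * z.2)
    (f := fun z : (N * Q) * (N * Q) => (z.1.1, a z.1.2 z.2.1))).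
    exact: mulg_morphism.
  apply: pair_morphism; first exact: (comp_morphism q1).
  apply: (comp_morphism (g := fun z : Q * N => a z.1 z.2)
    (f := fun z : (N * Q) * (N * Q) => (z.1.2, z.2.1))).
    exact: act_morphism.
  by apply: pair_morphism; [apply: (comp_morphism q2) | apply: (comp_morphism q1)].
apply: (comp_morphism (g := fun z : Q * Q => z.1 * z.2)
  (f := fun z : (N * Q) * (N * Q) => (z.1.2, z.2.2))).
  exact: mulg_morphism.
by apply: pair_morphism; apply: (comp_morphism q2).
Qed.

Lemma semidirect_inv_morphism : is_morphism (fun x : semidirect => x^-1).
Proof.
have q1 := @fst_morphism k N Q; have q2 := @snd_morphism k N Q.
have v2 : is_morphism (fun z : N * Q => z.2^-1).
  exact: (comp_morphism (@invg_morphism k Q)).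
apply: (@pair_morphism k (N * Q)%type N Q) => //.
apply: (comp_morphism (g := fun z : Q * N => a z.1 z.2)
  (f := fun z : N * Q => (z.2^-1, z.1^-1))).
  exact: act_morphism.
by apply: pair_morphism => //; apply: (comp_morphism (@invg_morphism k N)).
Qed.

HB.instance Definition _ := isAlgGroup.Build k semidirect
  semidirect_mul_morphism semidirect_inv_morphism.

End SemidirectProduct.

(* Main.v *)
(* If H = Ga x| Gm with Gm acting through a nontrivial character chi, then the
   normal factor Ga is made of commutators, so it is preserved by the
   automorphism phi of H induced by conjugation by an element g of the periodic
   component. As phi is linear on Ga, comparing phi (t x t^-1) with
   phi t phi x (phi t)^-1 shows that chi (phi t) = chi t; hence
   (g h)^n = h' g^n with chi h' = (chi h)^n. As g and all the g h have finite
   order, all the values of chi are roots of unity; but chi is a Laurent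
   monomial, and 2 is not a root of unity, so chi is trivial.
   Conversely, extend Gm x Ga by the inversion s: every h s squares to h h^-1. *)
From HB Require Import structures.
From mathcomp Require Import all_boot all_order all_algebra.
From mathcomp Require Import boolp classical_sets topology.
From mathcomp Require Import mpoly.
Require Import Defs.

Set Implicit Arguments.
Unset Strict Implicit.
Unset Printing Implicit Defensive.

Import GRing.Theory.

(** * Morphisms and connectedness in the Zariski topology *)

Section ZariskiTopology.
Local Open Scope classical_set_scope.
Local Open Scope ring_scope.
Variable k : closedFieldType.
Implicit Types X Y : affineVarietyType k.

Lemma zariski_openP X (U : set (zariski X)) :
  open U <-> exists S, U = [set x | ~ zero_locus S (coord (x : X))].
Proof.
split=> [[W [S ->] <-]|[S ->]]; first by exists S.
by exists (~` zero_locus S) => //; exists S.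
Qed.

(** The equations of a closed set pull back along [f] by composing them with the polynomials that
    give [f] in coordinates. *)
Lemma morphism_continuous X Y (f : X -> Y) :
  is_morphism f -> continuous (f : zariski X -> zariski Y).
Proof.
move=> [P fP]; apply/continuousP => U /zariski_openP [S ->]; apply/zariski_openP.
exists [set p \mPo P | p in S]; apply/seteqP; split=> x /= + H; apply.
- move=> p Sp; have /= := H _ (ex_intro2 _ _ p Sp erefl).
  rewrite comp_mpoly_meval fP => <-; apply: meval_eq => i; by rewrite mxE.
- move=> _ [p Sp <-]; rewrite comp_mpoly_meval -(H p Sp) fP.
  by apply: meval_eq => i; rewrite mxE.
Qed.

Lemma connected_morphism_image X Y (f : X -> Y) (A : set (zariski X)) :
  is_morphism f -> connected A -> connected (f @` A : set (zariski Y)).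
Proof.
move=> fm cA; apply: (@connected_continuous_connected (zariski X) (zariski Y)) => //.
exact: (continuous_subspaceT (morphism_continuous fm)).
Qed.

(** A proper nonempty clopen set and its complement would be two disjoint nonempty open sets. *)
Lemma irreducible_connected (T : topologicalType) :
  (forall U V : set T, open U -> open V -> U !=set0 -> V !=set0 ->
    U `&` V !=set0) -> connected [set: T].
Proof.
move=> irr B B0 [U oU BU] [V cV BV]; rewrite setTI in BU; rewrite setTI in BV.
apply: contrapT => BT.
have [] := irr B (~` B).
- by rewrite BU.
- by rewrite BV; apply: closed_openC.
- exact: B0.
- by apply/set0P; apply: contra_notN BT => /eqP E; rewrite -[B]setCK E setC0.
- by move=> x [].
Qed.

Lemma connected_component_clopen (T : topologicalType) (D : set T) (x : T) :
  open D -> closed D -> D x -> connected_component [set: T] x `<=` D.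
Proof.
move=> oD cD Dx y Cy; set C := connected_component _ x in Cy.
suff : C `&` D = C by move=> E; move: Cy; rewrite -E => -[].
apply: component_connected; [|by exists D|by exists D].
by exists x; split=> //; apply: connected_component_refl.
Qed.

Lemma const_morphism X Y (y : Y) : is_morphism (fun _ : X => y).
Proof.
exists [tuple (coord y 0 i)%:MP | i < adim Y] => x; apply/rowP => i.
by rewrite mxE tnth_mktuple mevalC.
Qed.

Lemma id_morphism X : is_morphism (@id X).
Proof.
exists [tuple 'X_i | i < adim X] => x; apply/rowP => i.
by rewrite mxE tnth_mktuple mevalXU.
Qed.

End ZariskiTopology.

(** * Components of algebraic groups; transport along isomorphisms *)

Section AlgGroupComponents.
Local Open Scope classical_set_scope.
Local Open Scope group_scope.
Variable k : closedFieldType.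
Implicit Types G H : algGroupType k.

Lemma mul_morphism (X : affineVarietyType k) G (f g : X -> G) :
  is_morphism f -> is_morphism g -> is_morphism (fun x => f x * g x).
Proof.
move=> fm gm.
apply: (comp_morphism (g := fun z : G * G => z.1 * z.2)
  (f := fun x => (f x, g x))); first exact: mulg_morphism.
exact: pair_morphism.
Qed.

(** The image of the identity component is connected and contains [f 1]. Since [f] is any morphism
    of varieties, this covers translations as well as conjugations. *)
Lemma morphism_component G (f : G -> G) (x : G) :
  is_morphism f -> component 1 x -> component (f 1) (f x).
Proof.
move=> fm x1; suff : f @` component 1 `<=` component (f 1) by apply; exists x.
apply: (@connected_component_max (zariski G)) => //.
  by exists 1 => //; apply: connected_component_refl.
by apply: connected_morphism_image fm _; apply: component_connected.
Qed.

Lemma mulg_component G (g x : G) : component 1 x -> component g (g * x).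
Proof.
have gm : is_morphism (fun y : G => g * y).
  by apply: mul_morphism; [apply: const_morphism | apply: id_morphism].
by move=> /(morphism_component gm); rewrite mulg1.
Qed.

Lemma conj_morphism G (g : G) : is_morphism (fun x => g * x * g^-1).
Proof.
apply: mul_morphism; last exact: const_morphism.
by apply: mul_morphism; [apply: const_morphism | apply: id_morphism].
Qed.

Lemma conjg_component G (g x : G) : component 1 x -> component 1 (g * x * g^-1).
Proof.
by move=> /(morphism_component (conj_morphism g)); rewrite mulg1 mulgV.
Qed.

Lemma isomorphic_sym G H : isomorphic G H -> isomorphic H G.
Proof.
move=> [f [g [fK gK fM fm gm]]]; exists g, f; split=> // x y.
by rewrite -{1}[x]gK -{1}[y]gK -fM fK.
Qed.

Lemma isomorphic_trans G H K :
  isomorphic G H -> isomorphic H K -> isomorphic G K.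
Proof.
move=> [f [g [fK gK fM fm gm]]] [f' [g' [fK' gK' fM' fm' gm']]].
exists (fun x => f' (f x)), (fun x => g (g' x)); split.
- by move=> x; rewrite fK' fK.
- by move=> x; rewrite gK gK'.
- by move=> x y; rewrite fM fM'.
- exact: comp_morphism.
- exact: comp_morphism.
Qed.

Lemma isomorphic_extension G H : isomorphic G H ->
  has_finite_extension_with_periodic_component G ->
  has_finite_extension_with_periodic_component H.
Proof.
move=> [f [g [fK gK fM [F fF] gm]]] [E [i [[iM im [Q iQ] iR] per]]].
exists E, (fun x => i (g x)); split=> //; split.
- by move=> x y; rewrite -iM -{1}[x]gK -{1}[y]gK -fM fK.
- exact: comp_morphism.
(* As h = f (g h), composing [F] with [Q] recovers the coordinates of h from those of i (g h). *)
- exists [tuple tnth F j \mPo Q | j < adim H] => h; apply/rowP => j.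
  rewrite -{1}[h]gK fF !mxE tnth_mktuple comp_mpoly_meval.
  by apply: meval_eq => l; rewrite iQ mxE.
- rewrite -iR; apply/seteqP; split=> [_ [h _ <-]|_ [x _ <-]]; first by exists (g h).
  by exists (f x) => //; rewrite fK.
Qed.

End AlgGroupComponents.

(** * Regular functions along curves in the product of torus and additive group *)

Section MultiplicativeTimesAdditive.
Local Open Scope classical_set_scope.
Local Open Scope ring_scope.
Variable k : closedFieldType.

(** Each variable contributes one factor [D] to the denominator, so a monomial [m] needs the
    exponent [mdeg m]; the induction adds these exponents instead of taking their maximum. *)
Lemma meval_clear_denominator n (p : {mpoly k[n]}) (P : 'I_n -> {poly k})
    (D : {poly k}) :
  exists N (R : {poly k}), forall s, D.[s] != 0 ->
    p.@[fun i => (P i).[s] / D.[s]] * D.[s] ^+ N = R.[s].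
Proof.
elim/mpolyind: p => [|c m p _ _ [N [R pR]]].
  by exists 0%N, 0 => s _; rewrite meval0 mul0r horner0.
exists (mdeg m + N)%N,
  (c *: (\prod_i P i ^+ m i) * D ^+ N + R * D ^+ mdeg m) => s Ds.
rewrite mevalD mevalZ mevalX mulrDl !hornerE horner_prod exprD.
rewrite [p.@[_] * _]mulrCA pR // [D.[s] ^+ mdeg m * R.[s]]mulrC mulrA; congr (_ * _ + _).
rewrite -mulrA mdegE -prodrXr -big_split /=; congr (_ * _).
by apply: eq_bigr => i _; rewrite horner_exp -exprMn divfK.
Qed.

Lemma meval_curve (p : {mpoly k[adim (Gm k * Ga k)%type]}) (D X : {poly k}) :
  exists N (R : {poly k}), forall (t : Gm k) (x : Ga k) s,
    val t = D.[s] -> x = X.[s] ->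
    p.@[coord ((t, x) : Gm k * Ga k) 0] * D.[s] ^+ N = R.[s].
Proof.
(* Over the common denominator [D], the coordinates D, 1/D and X of the curve have numerators D^2, 1
   and X D. *)
pose P (i : 'I_(2 + 1)) : {poly k} := match split i with
  | inl j => if j == 0 then D ^+ 2 else 1 | inr _ => X * D end.
have [N [R pR]] := meval_clear_denominator p P D.
exists N, R => t x s tD xX; have Ds : D.[s] != 0 by rewrite -tD (valP t).
rewrite -pR //; congr (_ * _); apply: meval_eq => i.
rewrite [LHS]mxE /P; case: (split i) => j; rewrite /coord /= mxE.
  by case: ifP => _; rewrite !hornerE tD ?mul1r // expr2 mulfK.
by rewrite hornerE mulfK.
Qed.

(* Two nonempty open sets meet on the line joining a point of one to a point of
   the other, since only finitely many points of this line are excluded. *)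
Lemma zariski_Gm_Ga_connected : connected [set: zariski (Gm k * Ga k)%type].
Proof.
apply: irreducible_connected => U V /zariski_openP [S ->] /zariski_openP [T ->].
move=> [[t1 x1] /existsNP [p /not_implyP [Sp /eqP p1]]].
move=> [[t2 x2] /existsNP [q /not_implyP [Tq /eqP q2]]].
pose D : {poly k} := (val t1)%:P + (val t2 - val t1) *: 'X.
pose X : {poly k} := x1%:P + ((x2 : k) - (x1 : k)) *: 'X.
have D0 : D.[0] = val t1 by rewrite !hornerE.
have D1 : D.[1] = val t2 by rewrite hornerD hornerC hornerZ hornerX mulr1 addrC subrK.
have X0 : X.[0] = x1 by rewrite !hornerE.
have X1 : X.[1] = x2 by rewrite hornerD hornerC hornerZ hornerX mulr1 addrC subrK.
have [M [P pP]] := meval_curve p D X; have [N [Q qQ]] := meval_curve q D X.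
(* At a parameter that is not a root of this product, the torus coordinate is nonzero and neither
   [p] nor [q] vanishes. *)
have : P * Q * D != 0.
  rewrite !mulf_neq0 //.
  - apply: contraNneq p1 => P0; have := pP t1 x1 0 (esym D0) (esym X0).
    rewrite P0 horner0 => /eqP.
    by rewrite mulf_eq0 expf_eq0 D0 (negPf (valP t1)) andbF orbF.
  - apply: contraNneq q2 => Q0; have := qQ t2 x2 1 (esym D1) (esym X1).
    rewrite Q0 horner0 => /eqP.
    by rewrite mulf_eq0 expf_eq0 D1 (negPf (valP t2)) andbF orbF.
  - by apply: contraTneq (valP t1) => D_0; rewrite -D0 D_0 horner0 eqxx.
move=> /closed_nonrootP [s]; rewrite !rootM !negb_or => /andP[/andP[Ps Qs] Ds].
exists (exist _ D.[s] Ds, X.[s]); split=> /=.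
  move=> /(_ p Sp) E; move: Ps; rewrite /root -(pP (exist _ D.[s] Ds) X.[s]) //.
  by rewrite E mul0r eqxx.
move=> /(_ q Tq) E; move: Qs; rewrite /root -(qQ (exist _ D.[s] Ds) X.[s]) //.
by rewrite E mul0r eqxx.
Qed.

(** After the zero at 0 is split off with its full multiplicity, the cofactor has no root at all, so
    it is constant over an algebraically closed field. *)
Lemma monomial_of_nonroot (P : {poly k}) :
  (forall x, x != 0 -> ~~ root P x) -> exists m c, P = c *: 'X^m.
Proof.
move=> Pn; have [m [q q0 PE]] := multiplicity_XsubC P 0.
have Pneq : P != 0 by apply/closed_nonrootP; exists 1; apply: Pn; exact: oner_neq0.
exists m, q`_0; rewrite PE subr0 -mul_polyC; congr (_ * _).
apply: size1_polyC; have [/eqP -> //|/closed_rootP [x qx]] := boolP (size q == 1%N).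
exfalso; have [x0|x0] := eqVneq x 0.
  by move: q0; rewrite Pneq -x0 qx.
by have := Pn x x0; rewrite PE rootM qx.
Qed.

(** * Endomorphisms of the additive group and characters of the torus in characteristic zero *)

Hypothesis char0 : [pchar k] =i pred0.

Lemma natr_inj_char0 : injective (fun n => n%:R : k).
Proof.
suff le m n : (m <= n)%N -> m%:R = n%:R :> k -> m = n.
  by move=> m n mn; case/orP: (leq_total m n) => /le; [apply|move/(_ (esym mn))].
move=> mn E; apply/eqP; rewrite eqn_leq mn -subn_eq0 -((pcharf0P k).1 char0).
by rewrite natrB // E subrr eqxx.
Qed.

Lemma poly_nat_roots (p : {poly k}) : (forall n, root p n%:R) -> p = 0.
Proof.
move=> pn; pose rs := [seq (n%:R : k) | n <- iota 0 (size p)].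
apply: (@roots_geq_poly_eq0 _ _ rs); last by rewrite size_map size_iota.
  by apply/allP => _ /mapP [n _ ->].
by rewrite map_inj_uniq ?iota_uniq //; exact: natr_inj_char0.
Qed.

(** An additive polynomial function agrees with x f(1) at every natural number, hence at infinitely
    many points. *)
Lemma Ga_endomorphism_linear (f : Ga k -> Ga k) : is_morphism f ->
  {morph f : x y / (x * y)%g} -> forall x, f x = (x : k) * (f (1 : k) : k) :> k.
Proof.
move=> fm fD.
have [P fP] := comp_morphism fm (@snd_morphism k (Gm k) (Ga k)).
(* With the torus coordinate fixed at 1 there is no denominator, so [f] itself is the polynomial
   [R]. *)
have [N [R PR]] := meval_curve (tnth P 0) 1 'X.
have fR x : f x = R.[x].
  rewrite -(PR 1%g x x) ?hornerE // expr1n mulr1.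
  by have /rowP/(_ 0) := fP (1%g, x); rewrite !mxE.
have fA (x y : k) : f (x + y : k) = (f x : k) + f y :> k by exact: fD.
have f0 : f (0 : k) = 0 :> k.
  by apply: (@addrI k (f (0 : k))); rewrite -fA !addr0.
have fn n : f (n%:R : k) = n%:R * f (1 : k) :> k.
  elim: n => [|n IHn]; first by rewrite mul0r.
  by rewrite -[in RHS]natr1 mulrDl -IHn mul1r -natr1 fA.
have : R - (f (1 : k) : k) *: 'X = 0.
  by apply: poly_nat_roots => n; rewrite /root !hornerE -fR fn mulrC subrr.
by move=> /subr0_eq RE x; rewrite fR RE !hornerE mulrC.
Qed.

Variable a : alg_action (Gm k) (Ga k).

(** The character through which the torus acts: [a t] is linear, so its value at 1 determines it. *)
Definition weight (t : Gm k) : k := a t (1 : k).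

Lemma act_weight t x : a t x = weight t * (x : k) :> k.
Proof.
rewrite mulrC; apply: (@Ga_endomorphism_linear (a t)); last exact: act_mulg.
apply: (comp_morphism (g := fun z : Gm k * Ga k => a z.1 z.2) (f := pair t)).
  exact: act_morphism.
by apply: pair_morphism; [apply: const_morphism | apply: id_morphism].
Qed.

Lemma weight1 : weight 1%g = 1.
Proof. by rewrite /weight act1. Qed.

Lemma weightM t u : weight (t * u)%g = weight t * weight u.
Proof. by rewrite {1}/weight actM act_weight. Qed.

Lemma weight_neq0 t : weight t != 0.
Proof.
apply: contra_eq_neq weight1 => t0.
by rewrite -(mulgV t) weightM t0 mul0r eq_sym oner_neq0.
Qed.

Lemma weight_torsion :
  (forall t, exists2 n, (0 < n)%N & weight t ^+ n = 1) -> forall t, weight t = 1.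
Proof.
move=> tors; have [P aP] := act_morphism a.
(* Along the points (t, 1), the weight times t^N is a polynomial in t without nonzero roots, so it
   is c t^m; the point t = 1 gives c = 1. *)
have [N [R PR]] := meval_curve (tnth P 0) 'X 1.
have wR (t : Gm k) : weight t * val t ^+ N = R.[val t].
  rewrite -(PR t (1 : k) (val t)) ?hornerE //; congr (_ * _).
  by have /rowP/(_ 0) := aP (t, 1 : k); rewrite !mxE.
have [x x0|m [c RE]] := @monomial_of_nonroot R.
  by rewrite /root -(wR (exist _ x x0)) mulf_neq0 ?expf_neq0 ?weight_neq0.
have c1 : c = 1.
  by have := wR 1%g; rewrite weight1 RE !hornerE !expr1n !mulr1.
have {}wR (t : Gm k) : weight t * val t ^+ N = val t ^+ m.
  by rewrite wR RE c1 !hornerE.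
have two0 : 2%:R != 0 :> k by rewrite ((pcharf0P k).1 char0).
have [n n0 w2] := tors (exist _ 2%:R two0).
suff Nm : N = m.
  move=> t; apply: (mulIf (expf_neq0 N (valP t))).
  by rewrite wR Nm mul1r.
(* Raising to the power [n] removes the weight and leaves two powers of 2, whose exponents must
   agree in characteristic zero. *)
have /(congr1 (fun y => y ^+ n)) := wR (exist _ 2%:R two0).
rewrite exprMn w2 mul1r /= -!exprM -!natrX => /natr_inj_char0 /eqP.
by rewrite eqn_exp2l // eqn_pmul2r // => /eqP.
Qed.

End MultiplicativeTimesAdditive.

(** * A periodic component forces the torus to act trivially *)

Section PeriodicImpliesTrivialAction.
Local Open Scope classical_set_scope.
Local Open Scope group_scope.
Variables (k : closedFieldType) (char0 : [pchar k]%R =i pred0).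
Variable a : alg_action (Gm k) (Ga k).
Let S : algGroupType k := semidirect a.
Let vec (x : Ga k) : S := (x, 1).
Let tor (t : Gm k) : S := (1, t).

Let pair_vec_tor (s : S) : s = vec s.1 * tor s.2.
Proof. by case: s => x t; congr pair; rewrite /= ?act1 ?mulg1 ?mul1g. Qed.

Let vecM : {morph vec : x y / x * y}.
Proof. by move=> x y; congr pair; rewrite /= ?act1 ?mulg1. Qed.

Let tor_vec t x : tor t * vec x = vec (a t x) * tor t.
Proof. by congr pair; rewrite /= ?mul1g ?mulg1 // act1 mulg1. Qed.

Let Gm_mulgC : forall x y : Gm k, x * y = y * x.
Proof. by move=> x y; apply/val_inj; apply: mulrC. Qed.

Section Endomorphism.
Variables (phi : S -> S) (t0 : Gm k).
Hypotheses (phiM : {morph phi : x y / x * y}) (phi_inj : injective phi).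
Hypotheses (phi_morphism : is_morphism phi) (t0_neq1 : weight a t0 != 1%R).

(** The commutator of [tor t0] and [vec y] is [vec] of (weight t0 - 1) y, and this factor is
    invertible by [t0_neq1]. *)
Let vec_commutator x : exists y, vec x * (vec y * tor t0) = tor t0 * vec y.
Proof.
exists ((x : k) / (weight a t0 - 1))%R; rewrite tor_vec mulgA -vecM.
congr (vec _ * _); rewrite (act_weight char0).
have w0 : (weight a t0 - 1 != 0)%R by rewrite subr_eq0.
set y := (_ / _)%R; change ((x : k) + y = weight a t0 * y)%R.
by rewrite -(divfK w0 x) -/y mulrBr mulr1 subrK mulrC.
Qed.

(** The projection to the torus is a homomorphism to a commutative group, so it kills the images of
    commutators. *)
Let phi_vec2 x : (phi (vec x)).2 = 1.
Proof.
have [y /(congr1 (fun s => (phi s).2))] := vec_commutator x.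
rewrite !phiM /= [RHS]Gm_mulgC => /(canRL (mulgK _)).
by rewrite mulgV.
Qed.

Lemma weight_endomorphism s : weight a (phi s).2 = weight a s.2.
Proof.
pose psi x := (phi (vec x)).1.
have phi_vec x : phi (vec x) = vec (psi x).
  by rewrite [LHS]surjective_pairing phi_vec2.
have psi_lin : forall x, psi x = ((x : k) * (psi (1%R : k) : k))%R :> k.
  apply: (Ga_endomorphism_linear char0).
    apply: (comp_morphism (g := fst) (f := fun x => phi (vec x))).
      exact: fst_morphism.
    apply: (comp_morphism phi_morphism).
    by apply: pair_morphism; [apply: id_morphism | apply: const_morphism].
  by move=> x y; rewrite /psi vecM phiM !phi_vec /= act1.
(* Injectivity of [phi] makes the slope of the linear map [psi] nonzero, so that it can be cancelled
   at the end. *)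
have psi1 : psi (1%R : k) != 0%R :> k.
  apply/eqP => p0; have : vec (1%R : k) = vec (0%R : k).
    by apply: phi_inj; rewrite !phi_vec p0 psi_lin mul0r.
  by move=> /(congr1 fst) /= /eqP; rewrite oner_eq0.
have phi2 : (phi s).2 = (phi (tor s.2)).2.
  by rewrite {1}[s]pair_vec_tor phiM phi_vec /= mul1g.
rewrite phi2; set t := s.2; set u := phi (tor t).
(* These are the additive coordinates of the image under [phi] of the relation [tor_vec] at the
   vector 1. *)
have : (u.1 + a u.2 (psi (1%R : k)) = psi (a t (1%R : k)) + u.1 :> k)%R.
  have := congr1 (fun s => (phi s).1) (tor_vec t (1%R : k)).
  by rewrite /= !phiM !phi_vec /= act1.
move=> E; apply: (mulIf psi1); rewrite -(act_weight char0) -psi_lin.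
by apply: (@addrI k u.1); rewrite E addrC.
Qed.

End Endomorphism.

Lemma periodic_component_weight (G : algGroupType k) (i : S -> G) (g : G) :
  is_finite_extension i -> periodic (component g) -> forall t, weight a t = 1%R.
Proof.
move=> [iM im [Q iQ] iR] per t1; apply/eqP; apply: contraT => t1_neq1.
have i_inj : injective i.
  by move=> x y xy; apply: (@coord_inj _ S); rewrite !iQ xy.
have i1 : i 1 = 1 by apply: (mulgI (i 1)); rewrite -iM !mulg1.
have iC s : component 1 (i s) by rewrite -[component _]iR; exists s.
(* Conjugation by [g] preserves the identity component, which is the image of [i], so it lifts to
   the group [S]. *)
have [phi phiE] : exists phi, forall s, i (phi s) = g * i s * g^-1.
  suff /choice [phi phiE] : forall s, exists r, i r = g * i s * g^-1 by exists phi.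
  move=> s.
  have := conjg_component g (iC s); rewrite -[component _]iR.
  by case=> r _ rE; exists r.
have phiM : {morph phi : x y / x * y}.
  by move=> x y; apply: i_inj; rewrite iM !phiE iM !mulgA mulgVK.
have phi_inj : injective phi.
  by move=> x y /(congr1 i); rewrite !phiE => /mulIg /mulgI /i_inj.
have phim : is_morphism phi.
  have [P PE] := comp_morphism (conj_morphism g) im.
  exists [tuple tnth Q j \mPo P | j < adim S] => s; apply/rowP => j.
  rewrite iQ !mxE tnth_mktuple comp_mpoly_meval.
  by apply: meval_eq => l; rewrite phiE PE mxE.
have phi_weight := weight_endomorphism phiM phi_inj phim t1_neq1.
(* In the induction, moving a factor [g] to the right past [i (s * r)] applies [phi], which does not
   change the weight. *)
have pow s n : exists r, (g * i s) ^+ n = i r * g ^+ n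
    /\ weight a r.2 = (weight a s.2 ^+ n)%R.
  elim: n => [|n [r [rE rw]]].
    by exists 1; rewrite i1 !expg0 mulg1 expr0 (weight1 a).
  exists (phi (s * r)); rewrite phi_weight (weightM char0) rw exprS; split=> //.
  by rewrite !expgS rE phiE iM !mulgA mulgVK.
suff : weight a t1 = 1%R by move/eqP; rewrite (negPf t1_neq1).
apply: (weight_torsion char0) => t.
have [m m0 gm] : exists2 m, (0 < m)%N & g ^+ m = 1.
  by apply: per; apply: connected_component_refl.
have [n n0 gn] := per _ (mulg_component g (iC (tor t))).
(* This exponent kills both [g] and [g * i (tor t)], so the factor [r] given by [pow] is trivial. *)
exists (n * m)%N; first by rewrite muln_gt0 n0.
have [r [rE <-]] := pow (tor t) (n * m)%N.
suff -> : r = 1 by apply: weight1.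
apply: i_inj; rewrite i1; move: rE.
by rewrite expgnA gn expg1n mulnC expgnA gm expg1n mulg1.
Qed.

End PeriodicImpliesTrivialAction.

(** * Extension of a commutative group by inversion *)

Section InversionExtension.
Local Open Scope classical_set_scope.
Local Open Scope ring_scope.
Variable k : closedFieldType.

(* The group of order two, as the points 0 and 1 of the affine line. The phantom
   dependency on k lets the ground field be inferred from the type. *)
Definition mu2 : Type := (fun _ : closedFieldType => bool) k.
HB.instance Definition _ := Choice.copy mu2 bool.
HB.instance Definition _ := isGroup.Build mu2
  addbA addFb addbF addbb addbb.

Definition mu2_coord (b : mu2) : 'rV[k]_1 := const_mx (b : bool)%:R.

Lemma mu2_coord_inj : injective mu2_coord.
Proof.
move=> x y /rowP /(_ 0) /eqP; rewrite !mxE.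
by case: x; case: y; rewrite ?oner_eq0 // eq_sym oner_eq0.
Qed.

Lemma mu2_coord_closed : exists S, range mu2_coord = zero_locus S.
Proof.
exists [set 'X_0 * ('X_0 - 1)]; apply/seteqP; split=> [_ [b _ <-] _ ->|v].
  by rewrite mevalM mevalB !mevalXU meval1 !mxE; case: b; rewrite ?subrr ?mulr0 ?mul0r.
move=> /(_ _ erefl) /eqP; rewrite mevalM mevalB !mevalXU meval1 mulf_eq0 subr_eq0.
by case/orP=> /eqP v0; [exists false|exists true] => //;
  apply/rowP => i; rewrite mxE ord1 v0.
Qed.

HB.instance Definition _ := isAffineVariety.Build k mu2
  mu2_coord_inj mu2_coord_closed.

Lemma mu2_mul_morphism : is_morphism (fun z : mu2 * mu2 => (z.1 * z.2)%g).
Proof.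
pose x : {mpoly k[1 + 1]} := 'X_(lshift 1 0).
pose y : {mpoly k[1 + 1]} := 'X_(rshift 1 0).
(* On the values 0 and 1, x + y - 2xy is exclusive or. *)
exists [tuple x + y - (x * y) *+ 2 | i < 1] => -[b c]; apply/rowP => i.
rewrite [RHS]mxE tnth_mktuple mevalB mevalD mevalMn mevalM !mevalXU.
rewrite row_mxEl row_mxEr !mxE /= (_ : (b * c)%g = b (+) c) //.
by case: b; case: c => /=;
  rewrite !(mulr0, mul0r, mulr1, addr0, add0r, subr0, mul0rn, mulr2n, subrr, oppr0).
Qed.

Lemma mu2_inv_morphism : is_morphism (fun x : mu2 => (x^-1)%g).
Proof. exact: id_morphism. Qed.

HB.instance Definition _ :=
  isAlgGroup.Build k mu2 mu2_mul_morphism mu2_inv_morphism.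

Lemma zariski_mu2_open (U : set (zariski mu2)) : open U.
Proof.
apply/zariski_openP.
exists [set p | forall b : mu2, ~ U b -> p.@[coord b 0] = 0].
apply/seteqP; split=> b; last by apply: contra_notP => Ub p; apply.
(* This polynomial is 1 at [b] and 0 at the other point. *)
move=> Ub /(_ (if b : bool then 'X_0 else 1 - 'X_0)).
have p1 : (if b : bool then 'X_0 else 1 - 'X_0 : {mpoly k[1]}).@[coord b 0] = 1.
  by case: b {Ub}; rewrite ?mevalB ?meval1 mevalXU mxE // subr0.
rewrite p1 => H; suff /eqP : 1 = 0 :> k by rewrite oner_eq0.
apply: H => c nUc; case: b c Ub nUc {p1} => -[] // _ _.
  by rewrite mevalXU mxE.
by rewrite mevalB meval1 mevalXU mxE subrr.
Qed.

Section InversionAction.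
Variables (N : algGroupType k) (mulNC : forall x y : N, (x * y = y * x)%g).

Let inv_act (b : mu2) (x : N) : N := if b : bool then x^-1%g else x.

Let inv_act1 x : inv_act 1%g x = x. Proof. by []. Qed.
Let inv_actM b c x : inv_act (b * c)%g x = inv_act b (inv_act c x).
Proof. by case: b; case: c; rewrite /inv_act /= ?invgK. Qed.
Let inv_act_mulg b : {morph inv_act b : x y / (x * y)%g}.
Proof. by case: b => // x y; rewrite /inv_act invgM mulNC. Qed.
Let inv_act_morphism : is_morphism (fun z : mu2 * N => inv_act z.1 z.2).
Proof.
have [P PE] := comp_morphism (@invg_morphism k N) (@snd_morphism k mu2 N).
pose x i : {mpoly k[1 + adim N]} := 'X_(rshift 1 i).
pose q i : {mpoly k[1 + adim N]} := tnth P i.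
(* In each coordinate, x + b (x^-1 - x) is the identity at b = 0 and the inversion at b = 1. *)
exists [tuple x i + 'X_(lshift (adim N) ord0) * (q i - x i) | i < adim N] => -[b y].
apply/rowP => i; rewrite [RHS]mxE tnth_mktuple mevalD mevalM mevalB !mevalXU.
have /rowP/(_ i) := PE (b, y); rewrite [in X in _ = X -> _]mxE /= => <-.
rewrite row_mxEl row_mxEr !mxE /=.
by case: b; rewrite /inv_act ?mul0r ?addr0 // mul1r addrC subrK.
Qed.

Definition inversion_action : alg_action mu2 N :=
  AlgAction inv_act1 inv_actM inv_act_mulg inv_act_morphism.

Let E : algGroupType k := semidirect inversion_action.

(** The fibres of the projection to the discrete group [mu2] are clopen, so a component lies in a
    single fibre. *)
Lemma component_inversion_extension (z w : E) : component z w -> w.2 = z.2.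
Proof.
pose f : zariski E -> zariski mu2 := snd.
have fc : continuous f by apply: morphism_continuous; apply: snd_morphism.
pose D : set (zariski E) := f @^-1` [set z.2].
have oD : open D by move/continuousP: fc; apply; apply: zariski_mu2_open.
have cD : closed D.
  move/continuous_closedP: fc; apply; rewrite -[X in closed X]setCK.
  by apply: open_closedC; apply: zariski_mu2_open.
exact: (connected_component_clopen oD cD).
Qed.

Lemma inversion_extension_periodic : connected [set: zariski N] ->
  has_finite_extension_with_periodic_component N.
Proof.
move=> cN; pose i (x : N) : E := (x, 1%g).
have im : is_morphism i.
  by apply: pair_morphism; [apply: id_morphism | apply: const_morphism].
exists E, i; split.
  split=> //.
    have [Q QE] := @fst_morphism k N mu2.
    by exists Q => h; rewrite -(QE (h, 1%g)).
  apply/seteqP; split=> [|[x b] /component_inversion_extension E1]; last first.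
    by exists x => //; congr pair; rewrite -[RHS]/(x, b).2 E1.
  apply: (@connected_component_max (zariski E)) => //.
  exact: connected_morphism_image.
(* All elements of this component have the form (x, true), and the square of such an element is (x
   x^-1, 1). *)
exists ((1%g, true) : E) => -[x b] /component_inversion_extension E1; rewrite [b]E1.
exists 2%N => //; rewrite expg2.
by change ((x * x^-1, 1)%g = 1%g :> E); rewrite mulgV.
Qed.

End InversionAction.
End InversionExtension.

(** * Trivial actions and the equivalence *)

Section SwapFactors.
Local Open Scope group_scope.
Variables (k : closedFieldType) (Q N : algGroupType k) (a : alg_action Q N).

(** The isomorphism exchanges the factors, because [semidirect] stores the normal factor first. *)
Lemma trivial_action_isomorphic : (forall q x, a q x = x) ->
  isomorphic (semidirect a) (Q * N)%type.
Proof.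
move=> aE; exists (fun s : N * Q => (s.2, s.1)), (fun z : Q * N => (z.2, z.1)).
split; try by case.
- by move=> [x q] [y r]; congr pair; rewrite /= aE.
- by apply: pair_morphism; [apply: snd_morphism | apply: fst_morphism].
- by apply: pair_morphism; [apply: snd_morphism | apply: fst_morphism].
Qed.

End SwapFactors.

Theorem proposition4 (k : closedFieldType) (char0 : [pchar k]%R =i pred0)
    (a : alg_action (Gm k) (Ga k)) (H : algGroupType k)
    (defH : isomorphic H (semidirect a)) :
  has_finite_extension_with_periodic_component H <->
  isomorphic H (Gm k * Ga k)%type.
Proof.
split=> [/(isomorphic_extension defH) [G [i [iH [g per]]]]|isoH].
  apply: isomorphic_trans defH _; apply: trivial_action_isomorphic => t x.
  by rewrite (act_weight char0) (periodic_component_weight char0 iH per) mul1r.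
apply: isomorphic_extension (isomorphic_sym isoH) _.
apply: inversion_extension_periodic; last exact: zariski_Gm_Ga_connected.
move=> [t x] [u y]; congr pair; last exact: addrC.
by apply/val_inj; apply: mulrC.
Qed.
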